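(* Let $N$ be a finite set of agents, $O$ a finite set of objects with copy numbers $(q_x)_{x\in O}$ satisfying $\sum_{x\in O}q_x\ge|N|$, and let $f:\mathcal{R}\to\Delta(\mathcal{M})$ be a random assignment rule on the domain $\mathcal{R}$ of all strict preference profiles. Then $f$ satisfies probabilistic monotonicity if and only if it satisfies assignment swap monotonicity, upper assignment invariance, and lower assignment invariance.
   Context: Setting. $N$ is a finite set of agents, $O$ a finite set of objects; object $x\in O$ has $q_x\geq 1$ copies, and $\sum_{x\in O}q_x\ge|N|$. Each agent $i$ has a strict preference $R_i$ over $O$ (a linear order) with asymmetric part $P_i$; $\mathcal{R}$ is the set of all profiles $R=(R_i)_{i\in N}$ of linear orders on $O$. $U(x,R_i)=\{y\in O:y\,P_i\,x\}$ and $L(x,R_i)=\{y\in O:x\,P_i\,y\}$. $N_{R_i}$ is the set of preferences $R_i'$ that differ from $R_i$ by swapping exactly two objects adjacent in $R_i$, all other comparisons being unchanged. An assignment is a map $\mu:N\to O$ with $|\{i:\mu_i=x\}|\le q_x$ for all $x$; $\mathcal{M}$ is the set of assignments, $\Delta(\mathcal{M})$ the set of probability distributions on $\mathcal{M}$. A random assignment rule is a map $f:\mathcal{R}\to\Delta(\mathcal{M})$; $f_\mu(R)$ is the probability of $\mu$ under $f(R)$. - Probabilistic monotonicity: for all $R,R'\in\mathcal{R}$ and $\mu\in\mathcal{M}$ with $U(\mu_i,R'_i)\subseteq U(\mu_i,R_i)$ for all $i\in N$, one has $f_\mu(R')\ge f_\mu(R)$. The following three axioms each quantify over all $i\in N$,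 $R\in\mathcal{R}$, and $R'_i\in N_{R_i}$, where $x,y$ denote the swapped objects, with $xP_iy$ and $yP'_ix$: - Assignment swap monotonicity: (i) $f_\mu(R'_i,R_{-i})\ge f_\mu(R)$ for all $\mu$ with $\mu_i=y$; and (ii) if $f_\mu(R'_i,R_{-i})=f_\mu(R)$ for all $\mu$ with $\mu_i=y$, then $f(R'_i,R_{-i})=f(R)$. - Upper assignment invariance: $f_\mu(R'_i,R_{-i})=f_\mu(R)$ for all $\mu$ with $\mu_i\in U(x,R_i)$. - Lower assignment invariance: $f_\mu(R'_i,R_{-i})=f_\mu(R)$ for all $\mu$ with $\mu_i\in L(y,R_i)$. *)

(* Defs.v *)
From HB Require Import structures.
From mathcomp Require Import all_boot all_order all_algebra.
From mathcomp Require Import boolp reals.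

Set Implicit Arguments.
Unset Strict Implicit.
Unset Printing Implicit Defensive.

Import Order.TTheory GRing.Theory Num.Theory.
Local Open Scope ring_scope.

Section Preferences.
Variable O : finType.

(* Relations are encoded as finite sets of pairs, and the axioms as a boolean, *)
(* so that two preferences making the same comparisons are equal.              *)
Definition linear_order (r : {set O * O}) : bool :=
  let le := [rel x y | (x, y) \in r] in
  `[< [/\ reflexive le, antisymmetric le, transitive le & total le] >].

Record pref := Pref { pref_set : {set O * O}; _ : linear_order pref_set }.
HB.instance Definition _ := [isSub for pref_set].
HB.instance Definition _ := [Finite of pref by <:].

(* [weak R x y] reads "x is at least as good as y". *)
Definition weak (R : pref) : rel O := fun x y => (x, y) \in pref_set R.
Definition strict (R : pref) : rel O := fun x y => weak R x y && ~~ weak R y x.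

Definition upper (x : O) (R : pref) : {set O} := [set y | strict R y x].
Definition lower (x : O) (R : pref) : {set O} := [set y | strict R x y].

Definition adjacent (R : pref) (x y : O) : Prop :=
  strict R x y /\ forall z, ~ (strict R x z /\ strict R z y).

(* The preferences obtained from R by swapping two objects adjacent in R. *)
Definition neighbour (R R' : pref) : Prop :=
  exists x y : O,
    [/\ adjacent R x y, strict R' y x &
        forall a b : O, (a, b) <> (x, y) -> (a, b) <> (y, x) ->
          weak R' a b = weak R a b].

End Preferences.

Section Distributions.
Variables (K : realType) (A : finType).

Definition is_dist (p : {ffun A -> K}) : bool :=
  [forall a, 0 <= p a] && (\sum_a p a == 1).

Record dist := Dist { dist_fun :> {ffun A -> K}; _ : is_dist dist_fun }.
HB.instance Definition _ := [isSub for dist_fun].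

End Distributions.

Section Rules.
Variables (K : realType) (N O : finType) (q : O -> nat).

Definition feasible (mu : {ffun N -> O}) : bool :=
  [forall x, #|[set i | mu i == x]| <= q x]%N.

Record assignment := Assignment
  { assignment_fun :> {ffun N -> O}; _ : feasible assignment_fun }.
HB.instance Definition _ := [isSub for assignment_fun].
HB.instance Definition _ := [Finite of assignment by <:].

Definition profile := {ffun N -> pref O}.

(* The profile (r, R_{-i}). *)
Definition update (R : profile) (i : N) (r : pref O) : profile :=
  [ffun j => if j == i then r else R j].

Definition random_rule := profile -> dist K assignment.

Definition probabilistic_monotonicity (f : random_rule) : Prop :=
  forall (R R' : profile) (mu : assignment),
    (forall i, upper (mu i) (R' i) \subset upper (mu i) (R i)) ->
    f R mu <= f R' mu.

(* In the next three axioms, x and y are the objects swapped between R i and   *)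
(* r: a neighbour reverses exactly one strict comparison.                      *)
Definition assignment_swap_monotonicity (f : random_rule) : Prop :=
  forall (i : N) (R : profile) (r : pref O), neighbour (R i) r ->
  forall x y : O, strict (R i) x y -> strict r y x ->
    (forall mu : assignment, mu i = y -> f R mu <= f (update R i r) mu)
    /\ ((forall mu : assignment, mu i = y -> f (update R i r) mu = f R mu) ->
        f (update R i r) = f R).

Definition upper_assignment_invariance (f : random_rule) : Prop :=
  forall (i : N) (R : profile) (r : pref O), neighbour (R i) r ->
  forall x y : O, strict (R i) x y -> strict r y x ->
  forall mu : assignment, mu i \in upper x (R i) ->
    f (update R i r) mu = f R mu.

Definition lower_assignment_invariance (f : random_rule) : Prop :=
  forall (i : N) (R : profile) (r : pref O), neighbour (R i) r ->
  forall x y : O, strict (R i) x y -> strict r y x ->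
  forall mu : assignment, mu i \in lower y (R i) ->
    f (update R i r) mu = f R mu.

End Rules.

(* Main.v *)
Require Import Defs.
From mathcomp Require Import all_boot all_order all_algebra.
From mathcomp Require Import boolp reals.
From mathcomp Require Import perm.

(** Necessity: swapping the adjacent objects [x], [y] only alters the upper
    contour sets of [x] and [y], which gives invariance off [x] and [y], an
    increase at [y] and a decrease at [x]; since probabilities sum to one, no
    change at [y] forces no change at [x].
    Sufficiency: replace the preferences one agent at a time, and carry each
    preference to its target by adjacent swaps that each remove an inversion
    with respect to the target. Along such a path the upper contour set of
    [mu i] always contains the target one, so [mu i] is never the object moved
    down, and every swap leaves the probability of [mu] unchanged or raises it. *)

Import Order.TTheory GRing.Theory Num.Theory.
Local Open Scope ring_scope.

(** * Linear orders on objects and swaps of adjacent objects *)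

Section Preferences.
Context {O : finType}.
Implicit Types (R T r : pref O) (x y z a b : O).

Lemma pref_linear R :
  [/\ reflexive (weak R), antisymmetric (weak R), transitive (weak R)
    & total (weak R)].
Proof. by case: R => s sP; have /asboolP := sP. Qed.

Lemma weak_refl R : reflexive (weak R).
Proof. by case: (pref_linear R). Qed.

Lemma weak_anti R : antisymmetric (weak R).
Proof. by case: (pref_linear R). Qed.

Lemma weak_trans R : transitive (weak R).
Proof. by case: (pref_linear R). Qed.

Lemma weak_total R : total (weak R).
Proof. by case: (pref_linear R). Qed.

Lemma strictE R x y : strict R x y = ~~ weak R y x.
Proof.
by rewrite /strict; case: (boolP (weak R y x)) (weak_total R x y);
  rewrite ?andbF ?orbF // => _ ->.
Qed.

Lemma strict_irr R x : strict R x x = false.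
Proof. by rewrite strictE weak_refl. Qed.

Lemma strict_neq R x y : strict R x y -> x != y.
Proof. by apply: contraTneq => ->; rewrite strict_irr. Qed.

Lemma strict_asym R x y : strict R x y -> ~~ strict R y x.
Proof. by rewrite (strictE R y) => /andP[-> _]. Qed.

Lemma strict_trans R : transitive (strict R).
Proof.
move=> y x z /andP[xy nyx] /andP[yz _]; rewrite strictE.
by apply: contra nyx => zx; apply: weak_trans yz zx.
Qed.

Lemma strict_total R x y : x != y -> strict R x y || strict R y x.
Proof.
apply: contraNT; rewrite !strictE negb_or !negbK => yxy.
by apply/eqP/(weak_anti R); rewrite andbC.
Qed.

Lemma weakE R x y : weak R x y = (x == y) || strict R x y.
Proof.
case: eqVneq => [->|nxy]; first by rewrite weak_refl.
case: (boolP (strict R x y)) => [/andP[] //|nsxy].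
by apply: negbTE; rewrite -strictE; move: (strict_total R _ _ nxy);
  rewrite (negbTE nsxy).
Qed.

Lemma pref_ext R T : (forall x y, weak R x y = weak T x y) -> R = T.
Proof. by move=> RT; apply/val_inj/setP => -[x y]; apply: RT. Qed.

(** Pulling [R] back along a permutation keeps it linear for free; the transposition of two adjacent
    objects then realizes their swap. *)
Definition relabel_set R (s : {perm O}) : {set O * O} :=
  [set p | weak R (s p.1) (s p.2)].

Lemma relabel_linear R s : linear_order (relabel_set R s).
Proof.
apply/asboolP; split=> [x|x y|y x z|x y]; rewrite /= !inE /=.
- exact: weak_refl.
- by move/weak_anti/perm_inj.
- exact: weak_trans.
- exact: weak_total.
Qed.

Definition relabel R s := Pref (relabel_linear R s).

Lemma weak_relabel R s x y : weak (relabel R s) x y = weak R (s x) (s y).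
Proof. by rewrite /weak /= inE. Qed.

Lemma adjacent_above {R x y z} : adjacent R x y -> z != x -> z != y ->
  strict R z x = strict R z y.
Proof.
move=> [xy none] zx zy; apply/idP/idP=> [zltx|zlty].
  exact: strict_trans zltx xy.
case/orP: (strict_total R _ _ zx) => // xz.
by case: (none z).
Qed.

Lemma adjacent_below {R x y z} : adjacent R x y -> z != x -> z != y ->
  strict R x z = strict R y z.
Proof.
move=> [xy none] zx zy; apply/idP/idP=> [xz|yz].
  case/orP: (strict_total R _ _ zy) => // zlty.
  by case: (none z).
exact: strict_trans xy yz.
Qed.

(** A third object lies on the same side of [x] and of [y], so exchanging their names does not
    affect comparisons with it. *)
Lemma neighbour_relabel R x y : adjacent R x y ->
  neighbour R (relabel R (tperm x y)).
Proof.
move=> adj; have [xy _] := adj; exists x, y; split=> // [|a b nxy nyx].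
  by rewrite strictE weak_relabel tpermL tpermR -strictE.
rewrite weak_relabel.
case: (tpermP x y a) nxy nyx => [->|->|/eqP ax /eqP ay];
  case: (tpermP x y b) => [->|->|/eqP bx /eqP by_] // _ _.
- by rewrite !weak_refl.
- by rewrite !weakE ![_ == b]eq_sym (negbTE bx) (negbTE by_) /=
    (adjacent_below adj).
- by rewrite !weak_refl.
- by rewrite !weakE ![_ == b]eq_sym (negbTE bx) (negbTE by_) /=
    (adjacent_below adj).
- by rewrite !weakE (negbTE ax) (negbTE ay) /= (adjacent_above adj).
- by rewrite !weakE (negbTE ax) (negbTE ay) /= (adjacent_above adj).
Qed.

Section Swap.
Variables (R r : pref O) (x y : O).
Hypotheses (Rr : neighbour R r) (Rxy : strict R x y) (ryx : strict r y x).

(** [neighbour] hides its swapped pair under an existential. The reversed comparison identifies it: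
    any other pair keeps its order, and the opposite orientation contradicts asymmetry of [R]. *)
Lemma neighbour_swap : adjacent R x y /\
  forall a b, (a, b) <> (x, y) -> (a, b) <> (y, x) ->
    strict r a b = strict R a b.
Proof.
have [x0 [y0 [adj _ same]]] := Rr.
suff [-> ->] : x = x0 /\ y = y0.
  split=> // a b n1 n2; rewrite !strictE same // => -[? ?].
    by apply: n2; congr pair.
  by apply: n1; congr pair.
case: (eqVneq (x, y) (x0, y0)) => [[-> ->] //|/eqP n1].
case: (eqVneq (x, y) (y0, x0)) => [[xE yE]|/eqP n2].
  by case: adj => /strict_asym; rewrite -xE -yE Rxy.
by move: ryx; rewrite strictE same //; case/andP: Rxy => ->.
Qed.

Lemma upper_swap z : z != x -> z != y -> upper z r = upper z R.
Proof.
move=> zx zy; have [_ same] := neighbour_swap; apply/setP=> a; rewrite !inE.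
by apply: same => -[_ zE]; move: zx zy; rewrite zE eqxx.
Qed.

Lemma upper_swap_up : upper y r = upper y R :\ x.
Proof.
have [_ same] := neighbour_swap; apply/setP=> a; rewrite !inE.
case: eqVneq => [->|/eqP ax]; first by apply: negbTE; apply: strict_asym.
by apply: same => -[] // _ yx; move: Rxy; rewrite yx strict_irr.
Qed.

Lemma upper_swap_down : upper x R = upper x r :\ y.
Proof.
have [_ same] := neighbour_swap; apply/setP=> a; rewrite !inE.
case: eqVneq => [->|/eqP ay]; first by apply: negbTE; apply: strict_asym.
by apply/esym/same => -[] // _ yx; move: Rxy; rewrite yx strict_irr.
Qed.

End Swap.

(** * Inversions, whose number is the Kendall tau distance *)

Definition inversions T R : {set O * O} :=
  [set p | strict T p.1 p.2 && strict R p.2 p.1].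

Lemma inversions0 T R : inversions T R = set0 -> T = R.
Proof.
move=> inv0.
have sub a b : strict T a b -> strict R a b.
  move=> ab; case/orP: (strict_total R _ _ (strict_neq _ _ _ ab)) => // ba.
  by have := in_set0 (a, b); rewrite -inv0 inE /= ab ba.
apply: pref_ext => a b; rewrite !weakE; congr (_ || _).
apply/idP/idP => [/sub //|ab]; move: (strict_asym _ _ _ ab).
by case/orP: (strict_total T _ _ (strict_neq _ _ _ ab)) => // /sub ->.
Qed.

(** Take an inversion with the fewest objects between its members in [T]. An object [z] in between
    would form, with one of the two ends, an inversion with a smaller gap. *)
Lemma adjacent_inversion T R : inversions T R != set0 ->
  exists x y, adjacent T x y /\ strict R y x.
Proof.
case/set0Pn => p0 p0inv.
pose gap (p : O * O) := #|[set z | strict T p.1 z && strict T z p.2]|.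
case: (arg_minnP (P := [in inversions T R]) gap p0inv) => -[x y].
rewrite inE => /andP[/= xy yx] gmin.
exists x, y; split=> //; split=> // z [xz zy].
have smaller (p : O * O) : p \in inversions T R ->
    (forall a, strict T p.1 a && strict T a p.2 ->
       strict T x a && strict T a y && (a != z)) -> False.
  move=> /gmin; rewrite leqNgt => /negP nlt sub; apply/nlt/proper_card.
  apply/properP; split; first by apply/subsetP=> a; rewrite !inE => /sub/andP[].
  exists z; rewrite !inE /= ?xz ?zy //.
  by apply/negP=> /sub; rewrite eqxx andbF.
(* If [R] puts [z] above [x], the pair [(x, z)] is inverted; otherwise [R] ranks [y], [x], [z] in
   this order and [(z, y)] is inverted. *)
case: (boolP (strict R z x)) => [zx|nzx].
- apply: (smaller (x, z)); rewrite ?inE /= ?xz // => a /andP[xa az].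
  by rewrite xa (strict_trans _ _ _ _ az zy) (strict_neq _ _ _ az).
- have yz : strict R y z.
    apply: strict_trans yx _; move: nzx.
    by case/orP: (strict_total R _ _ (strict_neq _ _ _ xz)) => // ->.
  apply: (smaller (z, y)); rewrite ?inE /= ?zy // => a /andP[za ay].
  by rewrite ay (strict_trans _ _ _ _ xz za) eq_sym (strict_neq _ _ _ za).
Qed.

(** The inversion [(x, y)] disappears, and none is created: [(y, x)] is not one, since [r] and [R]
    agree on it. *)
Lemma inversions_swap T r R x y : neighbour T r ->
  strict T x y -> strict r y x -> strict R y x ->
  (#|inversions r R| < #|inversions T R|)%N.
Proof.
move=> Tr Txy ryx Ryx; have [_ same] := neighbour_swap _ _ _ _ Tr Txy ryx.
apply/proper_card/properP; split; last first.
  by exists (x, y); rewrite !inE /= ?Txy ?Ryx // (negbTE (strict_asym _ _ _ ryx)).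
apply/subsetP => -[a b]; rewrite !inE /= => /andP[rab Rba]; rewrite Rba andbT.
rewrite -same // => -[aE bE]; move: rab Rba; rewrite aE bE.
  by rewrite (negbTE (strict_asym _ _ _ ryx)).
by rewrite (negbTE (strict_asym _ _ _ Ryx)).
Qed.

End Preferences.

(** * Comparison of probability distributions *)

Section Distributions.
Context {K : realType} {A : finType}.

Lemma dist_eq_le (p p' : dist K A) : (forall a, p a <= p' a) -> p = p'.
Proof.
move=> le; apply/val_inj/ffunP => a.
have sum1 (d : dist K A) : \sum_a d a = 1 by case: d => s sP; have /andP[_ /eqP] := sP.
have sum0 : \sum_a (p' a - p a) = 0 by rewrite sumrB !sum1 subrr.
have ge0 b : true -> 0 <= p' b - p b by rewrite subr_ge0.
by apply/esym/eqP; rewrite -subr_eq0 (psumr_eq0P ge0 sum0).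
Qed.

End Distributions.

(** * Changing one agent's preference, and necessity of the three axioms *)

Section Rules.
Context {K : realType} {N O : finType} {q : O -> nat}.
Implicit Types (f : random_rule K N q) (R : profile N O) (mu : assignment N q).

Lemma update_at R i r : update R i r i = r.
Proof. by rewrite ffunE eqxx. Qed.

Lemma update_id R i : update R i (R i) = R.
Proof. by apply/ffunP=> j; rewrite ffunE; case: eqP => [->|]. Qed.

Lemma update_update R i r r' : update (update R i r) i r' = update R i r'.
Proof. by apply/ffunP=> j; rewrite !ffunE; case: eqP. Qed.

Lemma monotone_update f R i r mu : probabilistic_monotonicity f ->
  upper (mu i) r \subset upper (mu i) (R i) -> f R mu <= f (update R i r) mu.
Proof.
move=> mono sub; apply: mono => j; rewrite ffunE.
by case: eqP => [->|].
Qed.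

Lemma monotone_update_rev f R i r mu : probabilistic_monotonicity f ->
  upper (mu i) (R i) \subset upper (mu i) r -> f (update R i r) mu <= f R mu.
Proof.
move=> mono sub; apply: mono => j; rewrite ffunE.
by case: eqP => [->|].
Qed.

Lemma monotone_swap_invariance {f} : probabilistic_monotonicity f ->
  forall i R r, neighbour (R i) r ->
  forall x y, strict (R i) x y -> strict r y x ->
  forall mu, mu i != x -> mu i != y -> f (update R i r) mu = f R mu.
Proof.
move=> mono i R r nb x y Rxy ryx mu mux muy.
have up := upper_swap _ _ _ _ nb Rxy ryx _ mux muy.
by apply/le_anti; rewrite monotone_update ?monotone_update_rev ?up.
Qed.

Lemma monotone_swap {f} :
  probabilistic_monotonicity f -> assignment_swap_monotonicity f.
Proof.
move=> mono i R r nb x y Rxy ryx.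
split=> [mu muy|eqy].
  apply: monotone_update => //.
  by rewrite muy (upper_swap_up _ _ _ _ nb Rxy ryx) subsetDl.
(* Both distributions have total mass one, so it is enough that the swap raises no probability; only
   assignments giving [x] to [i] can lose mass. *)
apply: dist_eq_le => mu.
case: (eqVneq (mu i) y) => [/eqy -> //|muy].
case: (eqVneq (mu i) x) => [mux|mux]; last first.
  by rewrite (monotone_swap_invariance mono _ _ _ nb _ _ Rxy ryx).
apply: monotone_update_rev => //.
by rewrite mux (upper_swap_down _ _ _ _ nb Rxy ryx) subsetDl.
Qed.

Lemma monotone_upper_invariance {f} :
  probabilistic_monotonicity f -> upper_assignment_invariance f.
Proof.
move=> mono i R r nb x y Rxy ryx mu; rewrite inE => mux.
apply: (monotone_swap_invariance mono _ _ _ nb _ _ Rxy ryx).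
  exact: strict_neq mux.
exact: strict_neq (strict_trans _ _ _ _ mux Rxy).
Qed.

Lemma monotone_lower_invariance {f} :
  probabilistic_monotonicity f -> lower_assignment_invariance f.
Proof.
move=> mono i R r nb x y Rxy ryx mu; rewrite inE => ymu.
apply: (monotone_swap_invariance mono _ _ _ nb _ _ Rxy ryx); rewrite eq_sym.
  exact: strict_neq (strict_trans _ _ _ _ Rxy ymu).
exact: strict_neq ymu.
Qed.

(** * Sufficiency of the three axioms *)

Section Sufficiency.
Variable f : random_rule K N q.
Hypotheses (swap : assignment_swap_monotonicity f)
  (upper_inv : upper_assignment_invariance f)
  (lower_inv : lower_assignment_invariance f).

(** Each axiom covers one position of [mu i]: at [y], above [x], or below [x], which by adjacency
    means below [y]. *)
Lemma swap_le R i r x y mu : neighbour (R i) r ->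
  strict (R i) x y -> strict r y x -> mu i != x ->
  f R mu <= f (update R i r) mu.
Proof.
move=> nb Rxy ryx mux; have [adj _] := neighbour_swap _ _ _ _ nb Rxy ryx.
case: (eqVneq (mu i) y) => [muy|muy].
  by have [+ _] := swap _ _ _ nb _ _ Rxy ryx; apply.
case/orP: (strict_total (R i) _ _ mux) => [above|below].
  by rewrite (upper_inv _ _ _ nb _ _ Rxy ryx) ?inE.
by rewrite (lower_inv _ _ _ nb _ _ Rxy ryx) ?inE // -(adjacent_below adj).
Qed.

Lemma update_le R i r mu :
  upper (mu i) r \subset upper (mu i) (R i) -> f R mu <= f (update R i r) mu.
Proof.
(* Strong induction on the number of inversions with respect to the target [r]. *)
have [n] := ubnP #|inversions (R i) r|; elim: n R => // n IHn R ltn sub.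
case: (eqVneq (inversions (R i) r) set0) => [/inversions0 <-|].
  by rewrite update_id.
case/adjacent_inversion => x [y [adj ryx]]; have [Rxy _] := adj.
pose t := relabel (R i) (tperm x y).
have nb : neighbour (R i) t by apply: neighbour_relabel.
have tyx : strict t y x by rewrite strictE weak_relabel tpermL tpermR -strictE.
(* Otherwise [y] would be above [mu i] in [r] but not in [R i], against [sub]. *)
have mux : mu i != x.
  apply: contraTneq sub => ->; apply/subsetPn; exists y; rewrite inE //.
  exact: strict_asym.
apply: le_trans (swap_le _ _ _ _ _ _ nb Rxy tyx mux) _.
rewrite -(update_update R i t r); apply: IHn; rewrite update_at.
  by apply: leq_trans (inversions_swap _ _ _ _ _ nb Rxy tyx ryx) _.
(* The inclusion must survive the swap. Only at [y] does the larger set shrink, and it loses just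
   [x], which [r] ranks below [y]. *)
case: (eqVneq (mu i) y) => [muy|muy]; last first.
  by rewrite (upper_swap _ _ _ _ nb Rxy tyx).
move: sub; rewrite muy (upper_swap_up _ _ _ _ nb Rxy tyx) subsetD1 => ->.
by rewrite inE strict_asym.
Qed.

Lemma swap_invariance_monotone : probabilistic_monotonicity f.
Proof.
move=> R R' mu sub.
(* Hybrid profiles: agents in [s] have already moved to [R']. Repetitions in [s] are harmless, since
   a second update changes nothing. *)
pose mix (s : seq N) : profile N O := [ffun j => if j \in s then R' j else R j].
have mix_le s : f R mu <= f (mix s) mu.
  elim: s => [|i s IHs].
    by rewrite (_ : mix [::] = R) //; apply/ffunP=> j; rewrite ffunE.
  apply: le_trans IHs _.
  rewrite (_ : mix (i :: s) = update (mix s) i (R' i)).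
    by apply: update_le; rewrite ffunE; case: ifP.
  by apply/ffunP=> j; rewrite !ffunE inE; case: eqP => [->|].
rewrite (_ : R' = mix (enum N)) //.
by apply/ffunP=> j; rewrite ffunE mem_enum.
Qed.

End Sufficiency.

End Rules.

Theorem proposition2 (K : realType) (N O : finType) (q : O -> nat)
    (q_gt0 : forall x : O, (0 < q x)%N)
    (q_enough : (#|N| <= \sum_(x : O) q x)%N)
    (f : random_rule K N q) :
  probabilistic_monotonicity f <->
  [/\ assignment_swap_monotonicity f,
      upper_assignment_invariance f
    & lower_assignment_invariance f].
Proof.
split=> [mono|[swap upper_inv lower_inv]].
  split; [exact: monotone_swap | exact: monotone_upper_invariance |].
  exact: monotone_lower_invariance.
exact: swap_invariance_monotone.
Qed.
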